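(* Let $\mathcal{A}\to\mathcal{B}$ be an arrow in the labelled category $\mathrm{StNaamen}$ (defined in the context). Then: (f) $\mathcal{A}\to\mathcal{B}$ is labelled (f) if and only if for every $A\in\mathcal{A}\cup\{\emptyset\}$, $B\in\mathcal{B}$ and finite subset $\{b_1,\dots,b_n\}\subseteq B$ there exists $A'\in\mathcal{A}\cup\{\emptyset\}$ such that $(A\cap B)\cup\{b_1,\dots,b_n\}\subseteq A'$. (wf) $\mathcal{A}\to\mathcal{B}$ is labelled (wf) if and only if for every $A\in\mathcal{A}\cup\{\emptyset\}$, $B\in\mathcal{B}$ and subset $B'\subseteq B$ with $\operatorname{card}B'\le\operatorname{card}(A\cap B)+\aleph_0$ there exists $A'\in\mathcal{A}\cup\{\emptyset\}$ such that $B'\subseteq A'$. (wc) $\mathcal{A}\to\mathcal{B}$ is labelled (wc) if and only if for every $B\in\mathcal{B}$ there is $A\in\mathcal{A}\cup\{\emptyset\}$ such that $B\setminus A$ is finite. (c) $\mathcal{A}\to\mathcal{B}$ is labelled (c) if and only if for every set $B$ with $\{B\}\to\mathcal{B}$ there exist $A\in\mathcal{A}\cup\{\emptyset\}$, $n\in\mathbb{N}$ and sets $B_0,\dots,B_n$ with $\{B_0,\dots,B_n\}\to\mathcal{B}$ such that $\operatorname{card}(A\cap B_0)+\aleph_0=\operatorname{card}B_0+\aleph_0$, $\operatorname{card}(B_i\cap B_{i+1})+\aleph_0=\operatorname{card}B_{i+1}+\aleph_0$ for all $0\le i<n$, and $B=B_n$. (w) $\mathcal{A}\to\mathcal{B}$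 is labelled (w) if and only if for every $A\in\mathcal{A}\cup\{\emptyset\}$, $B\in\mathcal{B}$ and subset $B'\subseteq B$ with $\operatorname{card}B'\le\operatorname{card}(A\cap B)+\aleph_0$ there exists $A'\in\mathcal{A}\cup\{\emptyset\}$ such that $B'\setminus A'$ is finite.
   Context: Conventions. For definiteness fix a strongly inaccessible cardinal $\kappa$; ''set'' means an element of $V_\kappa$ and ''class'' means a subset of $V_\kappa$ (any other standard treatment of classes would do). The category $\mathrm{StNaamen}$. Its objects are the nonempty classes of sets (the empty class is identified with $\{\emptyset\}$). There is a unique arrow $\mathcal{X}\to\mathcal{Y}$ if for every $X\in\mathcal{X}$ there is $Y\in\mathcal{Y}$ with $X\subseteq Y$, and no arrow $\mathcal X\to\mathcal Y$ otherwise. In particular $\{B\}\to\mathcal{B}$ means that the set $B$ is contained in some member of $\mathcal{B}$. Lifting. For arrows $\mathcal{X}\to\mathcal{Y}$ and $\mathcal{A}\to\mathcal{B}$, write $(\mathcal{X}\to\mathcal{Y})\pitchfork(\mathcal{A}\to\mathcal{B})$ if whenever there are arrows $\mathcal{X}\to\mathcal{A}$ and $\mathcal{Y}\to\mathcal{B}$ there is an arrow $\mathcal{Y}\to\mathcal{A}$. One says that the first arrow has the left lifting property with respect to the second, and the second has the right lifting property with respect to the first. Labelling of $\mathrm{StNaamen}$. (wc)$_0$: arrows $\{A\}\to\{B\}$ with $A \subseteq B$ sets and $B\setminus A$ finite. (c)$_0$: arrows $\{A\}\to\{B\}$ with $A\subseteq B$ sets and $\operatorname{card}B\le\operatorname{card}A+\aleph_0$.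 (f): arrows with the right lifting property with respect to all (wc)$_0$ arrows. (wf): arrows with the right lifting property with respect to all (c)$_0$ arrows. (wc): arrows with the left lifting property with respect to all (f) arrows. (c): arrows with the left lifting property with respect to all (wf) arrows. (w): arrows $\mathcal{X}\to\mathcal{Y}$ for which there is an object $\mathcal{Z}$ such that $\mathcal{X}\to\mathcal{Z}$ is a (wc) arrow and $\mathcal{Z}\to\mathcal{Y}$ is a (wf) arrow. *)

(* Defs.v *)
From HB Require Import structures.
From mathcomp Require Import all_boot.
From mathcomp Require Import boolp classical_sets functions cardinality.
From mathcomp Require Import generic_quotient.

Set Implicit Arguments.
Unset Strict Implicit.
Unset Printing Implicit Defensive.

Local Open Scope classical_set_scope.
Local Open Scope card_scope.
Local Open Scope quotient_scope.

(** Sets are the elements of the cumulative hierarchy over the types of one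
    universe (Aczel's well-founded trees, quotiented by extensional equality).
    That universe plays the role of the inaccessible cardinal [kappa]: [zfset]
    stands for [V_kappa], and classes are the arbitrary predicates on it. *)
Inductive tree : Type := Sup (T : Type) of (T -> tree).

Fixpoint exteq (x y : tree) : Prop :=
  match x, y with
  | Sup _ f, Sup _ g =>
      (forall i, exists j, exteq (f i) (g j)) /\
      (forall j, exists i, exteq (f i) (g j))
  end.

Lemma exteq_refl x : exteq x x.
Proof. by elim: x => I f IH; split=> i; exists i. Qed.

Lemma exteq_sym x y : exteq x y -> exteq y x.
Proof.
elim: x y => I f IH [J g] [fg gf]; split=> [j|i].
- by have [i /IH] := gf j; exists i.
- by have [j /IH] := fg i; exists j.
Qed.

Lemma exteq_trans x y z : exteq x y -> exteq y z -> exteq x z.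
Proof.
elim: x y z => I f IH [J g] [K h] [fg gf] [gh hg]; split=> [i|k].
- by have [j /IH fgij] := fg i; have [k /fgij] := gh j; exists k.
- by have [j ghjk] := hg k; have [i /IH fgij] := gf j; exists i; apply: fgij.
Qed.

HB.instance Definition _ := gen_eqMixin tree.
HB.instance Definition _ := gen_choiceMixin tree.

Definition exteqb : rel tree := fun x y => `[< exteq x y >].

Lemma exteqb_equiv : equiv_class_of exteqb.
Proof.
split=> [x|x y|y x z]; first exact/asboolP/exteq_refl.
- by apply/asboolP/asboolP; apply: exteq_sym.
- by move=> /asboolP xy /asboolP yz; apply/asboolP/(exteq_trans xy yz).
Qed.

Canonical exteqb_equiv_rel := EquivRelPack exteqb_equiv.

Definition zfset : Type := {eq_quot exteqb}.
HB.instance Definition _ := Choice.on zfset.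

Definition zsup (T : Type) (f : T -> tree) : zfset := \pi_({eq_quot exteqb}) (Sup f).

(** The class of elements of a set; through this coercion, inclusion, boolean
    operations, finiteness and cardinality of sets are those of classes. *)
Definition elements (x : zfset) : set zfset :=
  let: Sup _ f := repr (x : {eq_quot exteqb}) in
  range (fun i => \pi_({eq_quot exteqb}) (f i) : zfset).

Coercion elements : zfset >-> set.

Lemma elements_zsup (T : Type) (f : T -> tree) :
  elements (zsup f) = range (fun i => \pi_({eq_quot exteqb}) (f i) : zfset).
Proof.
rewrite /elements /zsup.
have : exteq (Sup f) (repr (\pi_({eq_quot exteqb}) (Sup f))).
  by apply/asboolP; have /eqmodP := esym (reprK (\pi_({eq_quot exteqb}) (Sup f))).
case: (repr _) => J g [fg gf]; apply/seteqP; split=> _ [i _ <-].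
- by have [j fgij] := gf i; exists j => //; apply/eqmodP/asboolP.
- have [j fgij] := fg i; exists j => //; apply/eqmodP/asboolP.
  exact: exteq_sym.
Qed.

Lemma zfset_ext (x y : zfset) : elements x = elements y -> x = y.
Proof.
elim/quotW: x => -[I f]; elim/quotW: y => -[J g].
rewrite -/(zsup f) -/(zsup g) !elements_zsup => fg.
apply/eqmodP/asboolP; split=> [i|j].
- have : range (fun i => \pi_({eq_quot exteqb}) (f i) : zfset)
    (\pi_({eq_quot exteqb}) (f i)) by exists i.
  by rewrite fg => -[j _ /eqmodP/asboolP/exteq_sym]; exists j.
- have : range (fun j => \pi_({eq_quot exteqb}) (g j) : zfset)
    (\pi_({eq_quot exteqb}) (g j)) by exists j.
  by rewrite -fg => -[i _ /eqmodP/asboolP]; exists i.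
Qed.

Definition zempty : zfset := zsup (of_void tree).

Lemma elements_zempty : elements zempty = set0.
Proof. by rewrite elements_zsup; apply/seteqP; split=> // _ [[]]. Qed.

(** A class of cardinality [card X + aleph_0]. *)
Definition plus_aleph0 (T : Type) (X : set T) : set (T + nat) :=
  (inl @` X) `|` range inr.

(** Objects and arrows of StNaamen: a thin category, so that an arrow is the
    proposition that it exists, and a label is a relation between objects. The
    empty class is not an object: it is identified with [[set zempty]]. *)
Record naam := Naam { members :> set zfset ; members_nonempty : members !=set0 }.

Definition arrow (X Y : naam) : Prop :=
  forall x, members X x -> exists2 y, members Y y & x `<=` y.

Lemma single_nonempty (A : zfset) : [set A] !=set0.
Proof. by exists A. Qed.

Definition single (A : zfset) : naam := Naam (single_nonempty A).

Lemma chain_nonempty (n : nat) (B : nat -> zfset) : B @` `I_n.+1 !=set0.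
Proof. by exists (B 0), 0. Qed.

Definition chain (n : nat) (B : nat -> zfset) : naam := Naam (chain_nonempty n B).

(** [lifts X Y A B] is the lifting relation between [X -> Y] and [A -> B];
    it is only meaningful when these two arrows exist, as they do below. *)
Definition lifts (X Y A B : naam) : Prop :=
  arrow X A -> arrow Y B -> arrow Y A.

Definition label_wc0 (X Y : naam) : Prop :=
  exists A B : zfset,
    [/\ X = single A, Y = single B, A `<=` B & finite_set (B `\` A)].

Definition label_c0 (X Y : naam) : Prop :=
  exists A B : zfset,
    [/\ X = single A, Y = single B, A `<=` B & B #<= plus_aleph0 A].

Definition label_f (A B : naam) : Prop :=
  arrow A B /\ forall X Y, label_wc0 X Y -> lifts X Y A B.

Definition label_wf (A B : naam) : Prop :=
  arrow A B /\ forall X Y, label_c0 X Y -> lifts X Y A B.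

Definition label_wc (X Y : naam) : Prop :=
  arrow X Y /\ forall A B, label_f A B -> lifts X Y A B.

Definition label_c (X Y : naam) : Prop :=
  arrow X Y /\ forall A B, label_wf A B -> lifts X Y A B.

Definition label_w (X Y : naam) : Prop :=
  arrow X Y /\ exists Z, label_wc X Z /\ label_wf Z Y.

Definition with_empty (X : naam) : set zfset := members X `|` [set zempty].

(* Main.v *)
Require Import Defs.
From mathcomp Require Import all_boot.
From mathcomp Require Import boolp classical_sets functions cardinality.
From mathcomp Require Import generic_quotient.

Set Implicit Arguments.
Unset Strict Implicit.
Unset Printing Implicit Defensive.

Local Open Scope classical_set_scope.
Local Open Scope card_scope.

(** An arrow out of a singleton is an inclusion into a member of a class, so a
    lifting problem for a generating arrow consists of a set [X] inside
    some member [A] of [cA] and a larger set [Y] inside some member [B] of [cB].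
    Then [X] lies in [A `&` B], and the hardest such problems start from
    [A `&` B] itself: this turns (f) and (wf) into conditions on [A] and [B].
    For (wf) one lifts [A `&` B] against [(A `&` B) `|` B'], so one has to know
    that the union is no larger than [card (A `&` B) + aleph_0]. This is
    cardinal arithmetic, reduced in [plus_aleph0_mul_nat] to Zorn's lemma.

    For (wc) and (c) the necessity of the conditions is a small object argument,
    without any transfinite iteration because arrows only record inclusions. The
    class of all sets over [cB] which lie in a member of [cA], or in the empty
    set, up to finitely many elements ([finite_completion]) already has the right
    lifting property against finite extensions. Likewise, the class of the ends
    of the finite chains of the statement ([chain_completion]) has it against the
    extensions which do not enlarge [card + aleph_0]. If [cA -> cB] is (wc) or
    (c), it lifts against the arrow from that class to [cB], so every member of
    [cB] lies in a member of that class.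

    For (w), if there is any factorization then [finite_completion] provides one:
    its arrow to [cB] is (wf) under the stated condition, as finitely many
    additional elements are absorbed by [aleph_0]. *)

(** * Cardinal arithmetic above [aleph_0] *)

Lemma card_le_injection {T U : Type} {A : set T} {B : set U} (f : T -> U) :
  set_fun A B f -> set_inj A f -> A #<= B.
Proof.
move=> fAB /inj_card_eq fA; rewrite -(card_le_eql fA).
by apply: subset_card_le => _ [x /fAB Bfx <-].
Qed.

(** The inhabitant [u0] provides the values of the injection outside of [A],
    which matters when [B] is empty. *)
Lemma card_le_injectionP {T U : Type} (u0 : U) {A : set T} {B : set U} :
  A #<= B -> exists2 f : T -> U, set_fun A B f & set_inj A f.
Proof.
elim/Ppointed: U => U in u0 B *; first by case: (no u0).
by move=> /pcard_leP[f]; exists f.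
Qed.

(** A maximal family of injective sequences in [X] with disjoint ranges leaves
    out only finitely many points: an infinite remainder would contain the range
    of one more sequence. *)
Lemma maximal_disjoint_sequences {T : Type} (X : set T) :
  exists G : set (nat -> T),
    [/\ forall g n, G g -> X (g n),
        forall g h m n, G g -> G h -> g m = h n -> g = h /\ m = n
      & finite_set (X `\` [set x | exists2 g, G g & exists n, g n = x])].
Proof.
pose P (G : set (nat -> T)) := (forall g n, G g -> X (g n)) /\
  forall g h m n, G g -> G h -> g m = h n -> g = h /\ m = n.
have [] := @Zorn_bigcup _ P.
  move=> F FP Ftot; split=> [g n [G /FP[GX _] Gg]|g h m n [G FG Gg] [H FH Hh]].
    exact: GX.
  have [GH|HG] := Ftot _ _ FG FH.
  - by have [_] := FP _ FH; apply => //; apply: GH.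
  - by have [_] := FP _ FG; apply => //; apply: HG.
move=> G [[GX Ginj] Gmax]; exists G; split=> //; apply: contrapT => Rinf.
(* a sequence [g0] in the remainder would extend the family *)
have [x0 _] := infinite_setN0 Rinf.
have [g0 g0R g0inj] := card_le_injectionP x0 ((infiniteP _).1 Rinf).
have g0NG h m n : G h -> g0 m <> h n.
  by move=> Gh ghE; have [_] := g0R m I; apply; exists h => //; exists n.
apply: (Gmax (G `|` [set g0])).
  split=> [|sub]; first exact: subsetUl.
  by apply: (g0NG g0 0 0) => //; apply: sub; right.
split=> [g n [/GX//|->]|g h m n]; first by have [] := g0R n I.
move=> [Gg|->] [Gh|->]; first exact: Ginj.
- by move=> /esym/g0NG-/(_ Gg).
- by move=> /g0NG-/(_ Gh).
- by move=> /g0inj ->; rewrite ?inE.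
Qed.

(** The set [X] is a disjoint union of copies of [nat], on each of which a
    pairing function absorbs the factor [nat], and of finitely many points,
    whose multiples go into the summand [nat] of [plus_aleph0 X]. *)
Lemma plus_aleph0_mul_nat {T : Type} (X : set T) :
  plus_aleph0 X `*` [set: nat] #<= plus_aleph0 X.
Proof.
have [G [GX Ginj /finite_set_countable/countable_injP[h hinj]]] :=
  maximal_disjoint_sequences X.
set U := [set x | _] in h hinj.
have [k kP] : {k : T -> (nat -> T) * nat &
    forall x, U x -> G (k x).1 /\ (k x).1 (k x).2 = x}.
  apply: (choice (P := fun x p => U x -> G p.1 /\ p.1 p.2 = x)) => x.
  have [[g Gg [n gn]]|NUx] := pselect (U x); first by exists (g, n).
  by exists (fun=> x, 0).
(* The tags [true] and [false] separate, inside the summand [nat], the images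
   of the leftover points of [X] from those of [nat] itself. *)
pose F (p : (T + nat) * nat) : T + nat :=
  match p.1 with
  | inl x => if pselect (U x) then inl ((k x).1 (pickle ((k x).2, p.2)))
             else inr (pickle (true, h x, p.2))
  | inr i => inr (pickle (false, i, p.2))
  end.
apply: (card_le_injection (f := F)).
  move=> [z m] [/= Xz _]; rewrite /F/=.
  case: z Xz => [x|i] Xz; last by right; eexists.
  case: pselect => Ux; last by right; eexists.
  by left; eexists => //; apply/GX; have [] := kP _ Ux.
have inlX x : plus_aleph0 X (inl x) -> X x by case=> [[y Xy [<-]]|[]].
move=> [z m] [z' m'] /set_mem[/= Xz _] /set_mem[/= Xz' _].
rewrite /F/=; case: z z' Xz Xz' => [x|i] [y|j].
- move=> /inlX Xx /inlX Xy; case: pselect => Ux; case: pselect => Uy //.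
  + have [Gx xE] := kP _ Ux; have [Gy yE] := kP _ Uy.
    move=> [/(Ginj _ _ _ _ Gx Gy) [g_eq /(pcan_inj pickleK)[n_eq ->]]].
    by rewrite -xE -yE g_eq n_eq.
  + move=> [/(pcan_inj pickleK)[hxy ->]].
    by rewrite (hinj x y) // inE.
- by case: pselect => // _ _ _ [/(pcan_inj pickleK)].
- by case: pselect => // _ _ _ [/(pcan_inj pickleK)].
- by move=> _ _ [/(pcan_inj pickleK)[-> ->]].
Qed.

Lemma card_le_setU_plus_aleph0 {S T : Type} {Y Z : set S} {X : set T} :
  Y #<= plus_aleph0 X -> Z #<= plus_aleph0 X -> Y `|` Z #<= plus_aleph0 X.
Proof.
move=> /(card_le_injectionP (inr 0))[f fY finj].
move=> /(card_le_injectionP (inr 0))[g gZ ginj].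
apply: card_le_trans (plus_aleph0_mul_nat X).
apply: (card_le_injection (f := fun x => if pselect (Y x) then (f x, 0) else (g x, 1))).
  move=> x YZx; case: pselect => [Yx|NYx]; split=> //=; first exact: fY.
  by apply: gZ; case: YZx.
move=> x y /set_mem YZx /set_mem YZy.
case: pselect => Yx; case: pselect => Yy // -[]; first by apply: finj; apply/mem_set.
by apply: ginj; apply/mem_set; [case: YZx|case: YZy].
Qed.

Lemma card_le_plus_aleph0 {T : Type} (X : set T) : X #<= plus_aleph0 X.
Proof. by apply: (card_le_injection (f := inl)) => [x Xx|x y _ _ [->]//]; left; exists x. Qed.

Lemma countable_le_plus_aleph0 {S T : Type} (Y : set S) (X : set T) :
  countable Y -> Y #<= plus_aleph0 X.
Proof.
move=> /countable_injP[f finj].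
apply: (card_le_injection (f := inr \o f)) => [y _|x y Yx Yy [/finj->//]].
by right; exists (f y).
Qed.

(** [plus_aleph0] is idempotent up to cardinality, so a bound may be composed
    with another one without accumulating summands. *)
Lemma plus_aleph0_le {S T : Type} {Y : set S} {X : set T} :
  Y #<= plus_aleph0 X -> plus_aleph0 Y #<= plus_aleph0 X.
Proof.
move=> YX; apply: card_le_setU_plus_aleph0.
  exact: card_le_trans (card_image_le _ _) YX.
by apply: countable_le_plus_aleph0; apply: card_le_trans (card_image_le _ _) _.
Qed.

Lemma plus_aleph0_sub {T : Type} {X Y : set T} :
  X `<=` Y -> plus_aleph0 X #<= plus_aleph0 Y.
Proof.
move=> XY; apply: plus_aleph0_le.
exact: card_le_trans (subset_card_le XY) (card_le_plus_aleph0 Y).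
Qed.

Lemma plus_aleph0_eq {T : Type} {X Y : set T} :
  X `<=` Y -> Y #<= plus_aleph0 X -> plus_aleph0 X #= plus_aleph0 Y.
Proof.
move=> XY YX.
by rewrite card_eq_le (plus_aleph0_le YX) (plus_aleph0_sub XY).
Qed.

(** * Sets and arrows out of singletons *)

(** Restricting the index type of [x] to a subtype stays in the same universe,
    so that any subclass of a set is a set. All the sets built below are
    obtained in this way. *)
Lemma zfset_separation {x : zfset} {P : set zfset} :
  P `<=` x -> exists y : zfset, P = y.
Proof.
elim/quotW: x => -[I f]; rewrite -/(zsup _) elements_zsup => Px.
pose J := {i : I | P (\pi_({eq_quot exteqb}) (f i))%qT}.
exists (zsup (fun j : J => f (sval j))); rewrite elements_zsup.
apply/seteqP; split=> [z Pz|_ [[i Pi] _ <-]//].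
by have [i _ iz] := Px _ Pz; rewrite -iz in Pz *; exists (exist _ i Pz).
Qed.

Lemma arrow_refl (X : naam) : arrow X X.
Proof. by move=> x Xx; exists x. Qed.

Lemma arrow_trans (X Y Z : naam) : arrow X Y -> arrow Y Z -> arrow X Z.
Proof.
by move=> XY YZ x /XY[y /YZ[z Zz yz] xy]; exists z => // u /xy/yz.
Qed.

Lemma arrow_member (X Y : naam) (x : zfset) :
  arrow X Y -> members X x -> arrow (single x) Y.
Proof. by move=> XY /XY[y Yy xy] _ ->; exists y. Qed.

Lemma arrow_singles (X Y : naam) :
  (forall x, members X x -> arrow (single x) Y) -> arrow X Y.
Proof. by move=> XY x /XY; apply. Qed.

Lemma sub_member_arrow {X : naam} {A x : zfset} :
  members X A -> x `<=` A -> arrow (single x) X.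
Proof. by move=> XA xA _ ->; exists A. Qed.

(** Adjoining the empty set to a class does not create new arrows, because an
    object has a member and this member contains the empty set. *)
Lemma sub_with_empty_arrow {X : naam} {A x : zfset} :
  with_empty X A -> x `<=` A -> arrow (single x) X.
Proof.
move=> [XA|->] xA; first exact: sub_member_arrow XA xA.
have [A' XA'] := members_nonempty X; apply: (sub_member_arrow XA') => z /xA.
by rewrite elements_zempty.
Qed.

Lemma arrow_single_with_empty {X : naam} {x : zfset} :
  arrow (single x) X -> exists2 A, with_empty X A & x `<=` A.
Proof. by move=> /(_ x erefl)[A XA xA]; exists A => //; left. Qed.

Lemma with_empty_arrow {X Y : naam} {A : zfset} :
  arrow X Y -> with_empty X A -> arrow (single A) Y.
Proof. by move=> XY XA; apply: arrow_trans (sub_with_empty_arrow XA _) XY. Qed.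

(** * Fibrations and acyclic fibrations *)

Lemma label_fP (cA cB : naam) (cAB : arrow cA cB) :
  label_f cA cB <->
    (forall A B F : zfset, with_empty cA A -> members cB B ->
       F `<=` B -> finite_set F ->
       exists2 A' : zfset, with_empty cA A' & (A `&` B) `|` F `<=` A').
Proof.
split=> [[_ fAB] A B F cA_A cB_B FB Ffin|fAB].
  have [X XE] := zfset_separation (@subIsetr _ A B).
  have [Y YE] : exists y : zfset, (A `&` B) `|` F = y.
    by apply: (@zfset_separation B); rewrite subUset; split => //; apply: subIsetr.
  rewrite YE; apply: arrow_single_with_empty.
  apply: (fAB (single X) (single Y)).
  - exists X, Y; split => //; rewrite -XE -YE; first exact: subsetUl.
    by rewrite setDUl setDv set0U; apply: finite_setD.
  - by apply: (sub_with_empty_arrow cA_A); rewrite -XE; apply: subIsetl.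
  - apply: (sub_member_arrow cB_B); rewrite -YE subUset.
    by split => //; apply: subIsetr.
split=> // _ _ [X [Y [-> -> XY finYX]]] XA YB.
have [A cA_A XA'] := arrow_single_with_empty XA.
have [B cB_B YB'] := YB Y erefl.
have [F FE] := zfset_separation (@subDsetl _ Y X).
have [||A' cA_A' sub] := fAB A B F cA_A cB_B; rewrite -?FE //.
  by move=> z [/YB'].
apply: (sub_with_empty_arrow cA_A') => z Yz; apply: sub; rewrite -FE.
by have [Xz|NXz] := pselect (elements X z); [left; split; [apply: XA'|apply: YB']|right].
Qed.

(** A lift of [B'] alone is not a generating problem, as [B'] need not contain
    [A `&` B]; one lifts the union, whose size is controlled by
    [card_le_setU_plus_aleph0]. *)
Lemma label_wfP (cA cB : naam) (cAB : arrow cA cB) :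
  label_wf cA cB <->
    (forall A B B' : zfset, with_empty cA A -> members cB B ->
       B' `<=` B -> B' #<= plus_aleph0 (A `&` B) ->
       exists2 A' : zfset, with_empty cA A' & B' `<=` A').
Proof.
split=> [[_ wfAB] A B B' cA_A cB_B B'B B'le|wfAB].
  have [X XE] := zfset_separation (@subIsetr _ A B).
  have [Y YE] : exists y : zfset, (A `&` B) `|` B' = y.
    by apply: (@zfset_separation B); rewrite subUset; split => //; apply: subIsetr.
  have [|A' cA_A' YA'] := @arrow_single_with_empty cA Y.
    apply: (wfAB (single X) (single Y)).
    - exists X, Y; split => //; rewrite -XE -YE; first exact: subsetUl.
      by apply: card_le_setU_plus_aleph0 => //; apply: card_le_plus_aleph0.
    - by apply: (sub_with_empty_arrow cA_A); rewrite -XE; apply: subIsetl.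
    - apply: (sub_member_arrow cB_B); rewrite -YE subUset.
      by split => //; apply: subIsetr.
  by exists A' => // z B'z; apply: YA'; rewrite -YE; right.
split=> // _ _ [X [Y [-> -> XY Yle]]] XA YB.
have [A cA_A XA'] := arrow_single_with_empty XA.
have [B cB_B YB'] := YB Y erefl.
have [|A' cA_A' sub] := wfAB A B Y cA_A cB_B YB'; last first.
  exact: (sub_with_empty_arrow cA_A').
apply: card_le_trans Yle (plus_aleph0_sub _).
by move=> z Xz; split; [apply: XA'|apply/YB'/XY].
Qed.

(** * Acyclic cofibrations *)

Section FiniteCompletion.
Variables (cA cB : naam) (cAB : arrow cA cB).

Definition finite_over (z : zfset) : Prop :=
  arrow (single z) cB /\
  exists2 A : zfset, with_empty cA A & finite_set (z `\` A).

Lemma finite_over_with_empty (A : zfset) : with_empty cA A -> finite_over A.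
Proof.
move=> cA_A; split; first exact: with_empty_arrow cAB _.
by exists A => //; rewrite setDv; apply: finite_set0.
Qed.

Lemma finite_over_nonempty : finite_over !=set0.
Proof.
by have [A cA_A] := members_nonempty cA; exists A; apply: finite_over_with_empty; left.
Qed.

Definition finite_completion : naam := Naam finite_over_nonempty.

Lemma arrow_finite_completion : arrow cA finite_completion.
Proof.
by move=> A cA_A; exists A => //; apply: finite_over_with_empty; left.
Qed.

Lemma finite_completion_arrow : arrow finite_completion cB.
Proof. by apply: arrow_singles => z []. Qed.

Lemma with_empty_finite_completion (z : zfset) :
  with_empty finite_completion z -> finite_over z.
Proof. by case=> // ->; apply: finite_over_with_empty; right. Qed.

(** If [Y] is a finite extension of [X] and [X] lies in [A] up to finitely many
    elements, then so does [Y]. *)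
Lemma label_f_finite_completion : label_f finite_completion cB.
Proof.
split=> [|_ _ [X [Y [-> -> XY finYX]]] XZ YB]; first exact: finite_completion_arrow.
have [Z [_ [A cA_A finZA]] XZ'] := XZ X erefl.
apply: (@sub_member_arrow finite_completion Y) => //; split => //.
exists A => //; apply: (@sub_finite_set _ _ ((Y `\` X) `|` (Z `\` A))).
  move=> z [Yz NAz]; have [Xz|NXz] := pselect (elements X z); last by left.
  by right; split => //; apply: XZ'.
by rewrite finite_setU.
Qed.

(** Lifting [cA -> cB] against [finite_completion -> cB] gives one direction. For
    the other, a member [B] of [cB] is a finite extension of [A `&` B], and a
    fibration lifts finite extensions. *)
Lemma label_wcP :
  label_wc cA cB <->
    (forall B : zfset, members cB B ->
       exists2 A : zfset, with_empty cA A & finite_set (B `\` A)).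
Proof.
split=> [[_ wcAB] B cB_B|wcAB].
  have [Z [_ [A cA_A finZA]] BZ] :=
    wcAB _ _ label_f_finite_completion arrow_finite_completion (@arrow_refl cB)
      B cB_B.
  by exists A => //; apply: sub_finite_set finZA; apply: setSD.
split=> // cC cD [_ fCD] AC BD; apply: arrow_singles => B cB_B.
have [A cA_A finBA] := wcAB B cB_B.
have [X XE] := zfset_separation (@subIsetr _ A B).
apply: (fCD (single X) (single B)).
- exists X, B; split => //; rewrite -XE; first exact: subIsetr.
  apply: sub_finite_set finBA => z [Bz NABz]; split => // Az.
  by apply: NABz.
- apply: arrow_trans AC; apply: (sub_with_empty_arrow cA_A).
  by rewrite -XE; apply: subIsetl.
- exact: arrow_member BD cB_B.
Qed.

End FiniteCompletion.

(** * Cofibrations *)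

Section AlmostEqualChains.
Variables (cA cB : naam) (cAB : arrow cA cB).

Definition reachable (B : zfset) : Prop :=
  exists (A : zfset) (n : nat) (B_ : nat -> zfset),
    [/\ with_empty cA A,
        arrow (chain n B_) cB,
        plus_aleph0 (A `&` B_ 0) #= plus_aleph0 (B_ 0),
        forall i, (i < n)%N ->
          plus_aleph0 (B_ i `&` B_ i.+1) #= plus_aleph0 (B_ i.+1)
      & B = B_ n].

Lemma reachable_member (A : zfset) : members cA A -> reachable A.
Proof.
move=> cA_A; exists A, 0, (fun=> A); split=> //; first by left.
  by move=> _ [i _ <-]; apply: cAB.
by rewrite setIid card_eqxx.
Qed.

(** The relation between consecutive sets of a chain only bounds the new set by
    its intersection with the previous one, which is what makes the class of
    chain ends closed under generating cofibrations. *)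
Lemma reachable_step (B C : zfset) :
  reachable B -> arrow (single C) cB -> C #<= plus_aleph0 (B `&` C) -> reachable C.
Proof.
move=> [A [n [B_ [cA_A chB AB0 stepB BE]]]] CB Cle.
exists A, n.+1, (fun i => if (i <= n)%N then B_ i else C); split=> //=.
- move=> _ [i _ <-]; case: leqP => [le_in|_]; last exact: CB.
  by apply: chB; exists i.
- move=> i; rewrite ltnS leq_eqVlt => /predU1P[->|lt_in].
    by rewrite eqxx ltnn /= -BE; apply: plus_aleph0_eq => //; apply: subIsetr.
  by rewrite lt_in orbT; apply: stepB.
- by rewrite ltnn.
Qed.

Lemma reachable_nonempty : reachable !=set0.
Proof.
by have [A cA_A] := members_nonempty cA; exists A; apply: reachable_member.
Qed.

Definition chain_completion : naam := Naam reachable_nonempty.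

Lemma arrow_chain_completion : arrow cA chain_completion.
Proof. by move=> A cA_A; exists A => //; apply: reachable_member. Qed.

Lemma chain_completion_arrow : arrow chain_completion cB.
Proof. by move=> _ [A [n [B_ [_ chB _ _ ->]]]]; apply: chB; exists n => /=. Qed.

Lemma label_wf_chain_completion : label_wf chain_completion cB.
Proof.
split=> [|_ _ [X [Y [-> -> XY Yle]]] XZ YB]; first exact: chain_completion_arrow.
have [Z rZ XZ'] := XZ X erefl.
apply: (@sub_member_arrow chain_completion Y) => //; apply: reachable_step rZ YB _.
apply: card_le_trans Yle (plus_aleph0_sub _).
by move=> z Xz; split; [apply: XZ'|apply: XY].
Qed.

(** Lifting [cA -> cB] against [chain_completion -> cB] places a set [B] over [cB]
    inside the end of a chain, and one more step reaches [B]. Conversely, an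
    acyclic fibration lifts the sets of a chain one after the other, as each
    extends its intersection with the previous one without enlarging the
    cardinality. *)
Lemma label_cP :
  label_c cA cB <-> forall B : zfset, arrow (single B) cB -> reachable B.
Proof.
split=> [[_ cABl] B BB|rB].
  have BC : arrow cB chain_completion :=
    cABl _ _ label_wf_chain_completion arrow_chain_completion (@arrow_refl cB).
  have [Z rZ BZ] := arrow_trans BB BC (erefl B).
  apply: (reachable_step rZ BB).
  by rewrite (setIidr BZ); apply: card_le_plus_aleph0.
split=> // cC cD [_ wfCD] AC BD; apply: arrow_singles => B cB_B.
have [A [n [B_ [cA_A chB AB0 stepB ->]]]] := rB B (arrow_member (@arrow_refl cB) cB_B).
have card_step (X Y : zfset) : plus_aleph0 (X `&` Y) #= plus_aleph0 Y ->
    arrow (single X) cC -> arrow (single Y) cD -> arrow (single Y) cC.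
  move=> XYE XC YD; have [Z ZE] := zfset_separation (@subIsetr _ X Y).
  apply: (wfCD (single Z) (single Y)) => //.
    exists Z, Y; split=> //; rewrite -ZE; first exact: subIsetr.
    by rewrite (card_le_eqr XYE); apply: card_le_plus_aleph0.
  move: XC => /(_ X erefl)[c Cc Xc]; apply: (sub_member_arrow Cc).
  by rewrite -ZE => z [/Xc].
have B_D i : (i <= n)%N -> arrow (single (B_ i)) cD.
  move=> le_in; apply: arrow_trans BD; apply: arrow_member chB _.
  by exists i => //=; rewrite ltnS.
suff B_C i : (i <= n)%N -> arrow (single (B_ i)) cC by apply: B_C.
elim: i => [|i IHi] lt_in.
  by apply: card_step AB0 _ (B_D 0 _) => //; apply: with_empty_arrow AC cA_A.
by apply: card_step (stepB _ lt_in) (IHi (ltnW lt_in)) (B_D _ lt_in).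
Qed.

End AlmostEqualChains.

(** * Weak equivalences *)

(** Composing the two factors gives the condition. Conversely it makes the
    arrow [finite_completion -> cB] satisfy [label_wfP]: the set [B']
    there is itself a member of the completion, and [Z `&` B] may be replaced by
    [A `&` B], which misses only finitely many of its elements. *)
Lemma label_wP (cA cB : naam) (cAB : arrow cA cB) :
  label_w cA cB <->
    (forall A B B' : zfset, with_empty cA A -> members cB B ->
       B' `<=` B -> B' #<= plus_aleph0 (A `&` B) ->
       exists2 A' : zfset, with_empty cA A' & finite_set (B' `\` A')).
Proof.
split=> [[_ [cZ [wcAZ wfZB]]] A B B' cA_A cB_B B'B B'le|wAB].
  have [AZ _] := wcAZ; have [ZB _] := wfZB.
  have [Z cZ_Z AZ'] := arrow_single_with_empty (with_empty_arrow AZ cA_A).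
  have [|Z' [cZ_Z'|->] B'Z'] := (label_wfP ZB).1 wfZB Z B B' cZ_Z cB_B B'B.
  - by apply: card_le_trans B'le (plus_aleph0_sub _); apply: setSI.
  - have [A' cA_A' finZA'] := (label_wcP AZ).1 wcAZ Z' cZ_Z'.
    by exists A' => //; apply: sub_finite_set finZA'; apply: setSD.
  - exists zempty; first by right.
    by apply: sub_finite_set (finite_set0 zfset) => z [/B'Z']; rewrite elements_zempty.
split=> //; exists (finite_completion cAB); split.
  by apply/label_wcP => [|Z [_]//]; apply: arrow_finite_completion.
apply/label_wfP => [|Z B B' /with_empty_finite_completion[_ [A cA_A finZA]]].
  exact: finite_completion_arrow.
move=> cB_B B'B B'le; exists B' => //; left; split.
  exact: (sub_member_arrow cB_B).
apply: (wAB A B B' cA_A cB_B B'B).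
apply: card_le_trans B'le (plus_aleph0_le _).
apply: (@card_le_trans _ _ _ ((A `&` B) `|` (Z `\` A))).
  apply: subset_card_le => z [Zz Bz].
  by have [Az|NAz] := pselect (elements A z); [left|right].
apply: card_le_setU_plus_aleph0; first exact: card_le_plus_aleph0.
exact/countable_le_plus_aleph0/finite_set_countable.
Qed.

Theorem proposition22 (cA cB : naam) (cAB : arrow cA cB) :
  [/\ label_f cA cB <->
        (forall A B F : zfset, with_empty cA A -> members cB B ->
           F `<=` B -> finite_set F ->
           exists2 A' : zfset, with_empty cA A' & (A `&` B) `|` F `<=` A'),
      label_wf cA cB <->
        (forall A B B' : zfset, with_empty cA A -> members cB B ->
           B' `<=` B -> B' #<= plus_aleph0 (A `&` B) ->
           exists2 A' : zfset, with_empty cA A' & B' `<=` A'),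
      label_wc cA cB <->
        (forall B : zfset, members cB B ->
           exists2 A : zfset, with_empty cA A & finite_set (B `\` A)),
      label_c cA cB <->
        (forall B : zfset, arrow (single B) cB ->
           exists (A : zfset) (n : nat) (B_ : nat -> zfset),
             [/\ with_empty cA A,
                 arrow (chain n B_) cB,
                 plus_aleph0 (A `&` B_ 0) #= plus_aleph0 (B_ 0),
                 forall i, (i < n)%N ->
                   plus_aleph0 (B_ i `&` B_ i.+1) #= plus_aleph0 (B_ i.+1)
               & B = B_ n])
    & label_w cA cB <->
        (forall A B B' : zfset, with_empty cA A -> members cB B ->
           B' `<=` B -> B' #<= plus_aleph0 (A `&` B) ->
           exists2 A' : zfset, with_empty cA A' & finite_set (B' `\` A'))].
Proof.
by split; [exact: label_fP|exact: label_wfP|exact: label_wcP|exact: label_cP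
  |exact: label_wP].
Qed.
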